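(* Let $Y=\{0,1\}^{\mathbb{Z}}$ be the full $2$-shift, let $X$ and $Z$ be the subshifts described in the context, and let $W=X\times Y\times Z$ with the product shift $\sigma$. Then every (nonempty) subsystem of $(W,\sigma)$, i.e. every nonempty closed $\sigma$-invariant subset of $W$, has positive topological entropy.
   Context: A subshift is a closed nonempty subset of $\mathcal{A}^{\mathbb{Z}}$ ($\mathcal{A}$ finite) invariant under the left shift $\sigma$; it is minimal if it has no nonempty proper subshift. Products of subshifts carry the product shift and are subshifts over the product alphabet. $\mathcal{L}(X)$ is the set of finite words occurring in elements of $X$. A minimal forbidden word of $X$ is a finite word not in $\mathcal{L}(X)$ all of whose proper subwords lie in $\mathcal{L}(X)$; $\mathcal{M}_n(X)$ is the set of those of length $n$. The SFT cover of a subshift $X$ is the sequence $(X_k)_{k\ge1}$ where $X_k$ is the set of $x\in\mathcal{A}^{\mathbb{Z}}$ in which no word of $\bigcup_{m=1}^k\mathcal{M}_m(X)$ occurs. The upper Banach density of $S\subseteq\mathbb{N}$ is $d^*(S)=\limsup_{n}\max_k |S\cap\{k,\dots,k+n-1\}|/n$; $X$ is language stable if $\{n\colon\mathcal{M}_n(X)=\emptyset\}$ has upper Banach density $1$. The shift $Z$: $\alpha\in(0,1)$ is irrational and $R_\alpha(x)=x+\alpha\pmod1$ on $[0,1)$. For $\beta\in(0,1)$, $X_\beta\subseteq\{0,1\}^{\mathbb{Z}}$ is the closure of the set of sequences $(x_j)_{j\in\mathbb{Z}}$, $x\in[0,1)$, with $x_j=0$ if $R_\alpha^jx\in[0,\beta)$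 and $x_j=1$ otherwise. $(\beta_i)_{i\ge1}$ is a strictly increasing sequence in $\{n\alpha\pmod1\colon n\ge1\}$ with $\lim_i\beta_i=\alpha$, chosen so that $Z:=\overline{\bigcup_{i}X_{\beta_i}}$ is language stable. Put $Z_j:=X_{\beta_j}$ ($j\in\mathbb{N}$) and $Z_c:=X_\alpha$. The shift $X$: fix intervals $\{i_n,\dots,i_n+j_n\}$, with $(i_n)$ and $(j_n)$ strictly increasing, such that the $i_n$-th and $(i_n+j_n)$-th terms of the SFT cover of $Z$ coincide for all $n$. $X\subseteq\{0,1\}^{\mathbb{Z}}$ is a language stable, minimal subshift with $h_{\mathrm{top}}(X)>0$, such that the $i_n$-th and $(i_n+j_n)$-th terms of the SFT cover of $X$ coincide for infinitely many $n$, and such that $X\times Z_c$ and all $X\times Z_j$ ($j\in\mathbb{N}$) are minimal. *)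

(* Defs.v *)
From HB Require Import structures.
From mathcomp Require Import all_boot all_order all_algebra.
From mathcomp Require Import all_classical all_reals all_analysis.

Set Implicit Arguments.
Unset Strict Implicit.
Unset Printing Implicit Defensive.

Import Order.TTheory GRing.Theory Num.Theory.
Import numFieldNormedType.Exports.

Local Open Scope classical_set_scope.
Local Open Scope ring_scope.

Definition config (A : finType) : Type :=
  prod_topology (fun _ : int => discrete_topology A).

HB.instance Definition _ (A : finType) := Topological.on (config A).

Section Subshifts.
Variable A : finType.
Implicit Types (X Y : set (config A)) (x : config A) (u w : seq A).

Definition shift x : config A := fun k : int => x (k + 1).

Definition subshift X : Prop :=
  [/\ X !=set0, closed X & shift @` X = X].

Definition minimal X : Prop :=
  subshift X /\ forall Y, subshift Y -> Y `<=` X -> Y = X.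

Definition occurs w x : Prop :=
  exists k : int, w = mkseq (fun n => x (k + n%:Z) : A) (size w).

Definition language X : set (seq A) := [set w | exists2 x, X x & occurs w x].

Definition language_of_length X (n : nat) : {set n.-tuple A} :=
  [set w : n.-tuple A | `[< language X w >]]%SET.

Definition minimal_forbidden (n : nat) X : set (seq A) :=
  [set w | [/\ size w = n, ~ language X w &
               forall u, infix u w -> u != w -> language X u]].

Definition sft_cover X (k : nat) : set (config A) :=
  [set x | forall m, (1 <= m <= k)%N ->
           forall w, minimal_forbidden m X w -> ~ occurs w x].

(* The sequence converges for every subshift (Fekete's lemma, since
   #|L_(m+n)| <= #|L_m| * #|L_n|), so this limsup is a limit. *)
Definition h_top (R : realType) X : \bar R :=
  limn_esup (fun n => (ln (#|language_of_length X n|%:R : R) / n%:R)%:E).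

End Subshifts.

Definition subshift_prod (A B : finType) (X : set (config A))
    (Y : set (config B)) : set (config (A * B)%type) :=
  [set w | X (fun k => (w k).1) /\ Y (fun k => (w k).2)].

(* The inner supremum ranges over finitely many values, hence is a maximum. *)
Definition upper_banach_density (R : realType) (S : set nat) : \bar R :=
  limn_esup (fun n => ereal_sup (range (fun k =>
    ((\sum_(k <= i < k + n | i \in S) 1)%N%:R / n%:R : R)%:E))).

Definition language_stable (R : realType) (A : finType) (X : set (config A)) :=
  upper_banach_density R [set n | minimal_forbidden n X = set0] = 1%:E.

Section RotationCodings.
Variables (R : realType) (alpha : R).

Definition mod1 (x : R) : R := x - (Num.floor x)%:~R.

Definition rotation (x : R) : R := mod1 (x + alpha).

(* Closed form of the j-th iterate of the rotation on [0, 1[, j in Z: see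
   rotation_iter0 and rotation_iterS. *)
Definition rotation_iter (j : int) (x : R) : R := mod1 (x + alpha *~ j).

Lemma mod1Dint (x : R) (n : int) : mod1 (x + n%:~R) = mod1 x.
Proof.
by rewrite /mod1 floorDrz ?intr_int// intrD intrKfloor opprD addrACA subrr addr0.
Qed.

Lemma rotation_iter0 x : 0 <= x < 1 -> rotation_iter 0 x = x.
Proof.
move=> x01; rewrite /rotation_iter mulr0z addr0 /mod1.
by rewrite (@floor_def _ _ 0) ?subr0// add0r.
Qed.

Lemma rotation_iterS j x :
  rotation_iter (j + 1) x = rotation (rotation_iter j x).
Proof.
rewrite /rotation /rotation_iter [in RHS]/mod1 -/(mod1 _) addrAC -mulrNz.
by rewrite mod1Dint mulrzDr mulr1z addrA.
Qed.

Definition coding (beta x : R) : config bool :=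
  fun j => ~~ (0 <= rotation_iter j x < beta).

Definition rotation_shift (beta : R) : set (config bool) :=
  closure [set coding beta x | x in `[0, 1[%classic].

(* beta n stands for the (n+1)-st term of the sequence (beta_i)_{i >= 1}. *)
Definition limit_shift (beta : nat -> R) : set (config bool) :=
  closure (\bigcup_n rotation_shift (beta n)).

End RotationCodings.

(* Main.v *)
(** Entropy does not increase under letterwise factor maps. The projection of a
    subsystem of [X * Y * Z] to its first coordinate is a subshift of the
    minimal shift [X], hence is all of [X]. *)
Require Import Defs.
From mathcomp Require Import all_boot all_order all_algebra.
From mathcomp Require Import all_classical all_reals all_analysis.
Import Order.TTheory GRing.Theory Num.Theory.
Import numFieldNormedType.Exports.
Local Open Scope classical_set_scope.
Local Open Scope ring_scope.

(** [limn_esup] is the infimum, over the sets of the filter [\oo], of the suprema on these sets, so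
    the comparison can be made on each set separately. *)
Lemma le_limn_esup (R : realType) (u v : nat -> \bar R) :
  (forall n, u n <= v n)%E -> (limn_esup u <= limn_esup v)%E.
Proof.
move=> uv; apply: le_ereal_inf_tmp => _ [N FN <-].
apply: (@le_trans _ _ (ereal_sup (u @` N))).
  by apply: ereal_inf_lbound; exists N.
apply: ge_ereal_sup => _ [n Nn <-]; apply: (le_trans (uv n)).
by apply: ereal_sup_ubound; exists n.
Qed.

Lemma ler_ln_nat (R : realType) (m n : nat) :
  (m <= n)%N -> ln m%:R <= ln n%:R :> R.
Proof.
case: m => [|m] mn.
  (* By convention [ln 0 = 0], which is at most the logarithm of any positive integer. *)
  by case: n mn => [|n] _ //; rewrite ln0// ln_ge0// ler1n.
by rewrite ler_ln ?posrE ?ltr0n ?ler_nat// (leq_trans _ mn).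
Qed.

(** The product topology is the supremum of the topologies induced by the projections, so
    convergence is tested on one coordinate at a time. *)
Lemma continuous_prod_topology (I : eqType) (K : I -> topologicalType)
    (T : topologicalType) (g : T -> prod_topology K) :
  (forall i, continuous (fun x => g x i)) -> continuous g.
Proof.
move=> cg x; apply/cvg_sup => i U [V] [[D oD <-] Dgx] /filterS; apply.
exact/(cg i)/open_nbhs_nbhs.
Qed.

Lemma config_compact (A : finType) : compact [set: config A].
Proof.
have /tychonoff : forall k : int, compact [set: discrete_topology A].
  by move=> k; apply: finite_compact; exact: (@finite_finset A).
by congr compact; apply/seteqP; split.
Qed.

Lemma config_hausdorff (A : finType) : hausdorff_space (config A).
Proof.
by apply: hausdorff_product => k; exact: discrete_hausdorff.
Qed.

(** The sliding block code with window of length one given by [f]. *)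
Definition letterwise {A B : finType} (f : A -> B) (x : config A) : config B :=
  fun k => f (x k).

Section Letterwise.
Variables (A B : finType) (f : A -> B).

Lemma letterwise_continuous : continuous (letterwise f).
Proof.
apply: (@continuous_prod_topology _ (fun=> discrete_topology B)) => k x U.
move=> /nbhs_singleton Ux.
apply: (@proj_continuous int (fun=> discrete_topology A) k x (f @^-1` U)).
by apply/open_nbhs_nbhs; split => //; exact: discrete_open.
Qed.

Lemma subshift_letterwise (X : set (config A)) :
  subshift X -> subshift (letterwise f @` X).
Proof.
move=> [[x Xx] Xcl Xsh]; split.
- by exists (letterwise f x), x.
(* Closedness passes to the image through compactness of the full shift over [A]. *)
- apply: compact_closed; first exact: config_hausdorff.
  apply: continuous_compact.
    by apply: continuous_subspaceT; exact: letterwise_continuous.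
  exact: subclosed_compact Xcl (@config_compact A) _.
(* [shift] and [letterwise f] commute by conversion. *)
- by rewrite -[in RHS]Xsh !image_comp.
Qed.

Lemma language_letterwise (X : set (config A)) (w : seq B) :
  language (letterwise f @` X) w -> exists2 v, language X v & w = map f v.
Proof.
move=> [_ [x Xx <-] [k ->]].
pose v := mkseq (fun n => x (k + n%:Z) : A) (size w).
exists v; last by rewrite -map_comp.
by exists x => //; exists k; rewrite size_mkseq.
Qed.

(** Words of the image lift to words of [X] of the same length, so [map_tuple f] maps the [n]-words
    of [X] onto a set containing those of the image. *)
Lemma card_language_letterwise (X : set (config A)) n :
  (#|language_of_length (letterwise f @` X) n| <= #|language_of_length X n|)%N.
Proof.
apply: leq_trans (leq_imset_card (map_tuple f) _).
apply/subset_leq_card/fintype.subsetP => w; rewrite inE => /asboolP.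
move=> /language_letterwise[v Xv wv].
have vn : size v == n by rewrite -(size_map f) -wv size_tuple.
apply/imsetP; exists (Tuple vn); last exact: val_inj.
by rewrite inE; apply/asboolP.
Qed.

Lemma h_top_letterwise (R : realType) (X : set (config A)) :
  (h_top R (letterwise f @` X) <= h_top R X)%E.
Proof.
(* The term [n = 0] needs no special care, since the inverse of [0] is [0]. *)
apply: le_limn_esup => n; rewrite lee_fin ler_wpM2r ?invr_ge0//.
exact/ler_ln_nat/card_language_letterwise.
Qed.

End Letterwise.

Theorem lemma6p18 (R : realType) (alpha : R) (beta : nat -> R)
    (i j : nat -> nat) (X : set (config bool))
    (Y := [set: config bool])
    (Z := limit_shift alpha beta)
    (Zc := rotation_shift alpha alpha)
    (Zj := fun n => rotation_shift alpha (beta n))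
    (W := subshift_prod (subshift_prod X Y) Z)
    (alpha01 : 0 < alpha < 1)
    (alpha_irr : irrational alpha)
    (beta_incr : increasing_seq beta)
    (beta_orbit : forall k, exists2 n : nat, (1 <= n)%N &
                    beta k = mod1 (alpha *+ n))
    (beta_lim : beta @ \oo --> alpha)
    (Z_stable : language_stable R Z)
    (i_ge1 : forall n, (1 <= i n)%N)
    (i_incr : increasing_seq i)
    (j_incr : increasing_seq j)
    (Z_cover : forall n, sft_cover Z (i n) = sft_cover Z (i n + j n)%N)
    (X_minimal : minimal X)
    (X_stable : language_stable R X)
    (X_entropy : (0 < h_top R X)%E)
    (X_cover : infinite_set
       [set n | sft_cover X (i n) = sft_cover X (i n + j n)%N])
    (XZc_minimal : minimal (subshift_prod X Zc))
    (XZj_minimal : forall n, minimal (subshift_prod X (Zj n))) :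
  forall V : set (config (bool * bool * bool)%type),
    subshift V -> V `<=` W -> (0 < h_top R V)%E.
Proof.
move=> V Vsub VW.
(* The product [W] associates to the left, so the letter of [X] sits in the innermost pair. *)
pose first (a : bool * bool * bool) := a.1.1.
have VX : letterwise first @` V = X.
  apply: X_minimal.2; first exact: subshift_letterwise.
  by move=> _ [w /VW[[Xw _] _] <-].
by apply: lt_le_trans X_entropy _; rewrite -VX; exact: h_top_letterwise.
Qed.
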